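(* Let $G$ be a finite group, $N$ a normal subgroup of $G$, $b$ a $p$-block of $N$ and $B$ a $p$-block of $G$ covering $b$. Let $D_B$ be a defect group of $B$ and let $\varphi_1,\dots,\varphi_{l(B)}$ be the irreducible Brauer characters in $B$. If $D_B\le N$ and $N$ is $p$-solvable, then $$\frac{\dim_F B}{|D_B|}\ \le\ \sum_{i=1}^{l(B)}\varphi_i(1)^2.$$
   Context: $F$ is a field of characteristic $p>0$ that is a splitting field for the groups considered. $B$ is regarded as a block algebra (two-sided ideal direct summand) of $F[G]$. $l(B)$ denotes the number of irreducible Brauer characters in $B$. *)

(* Defs.v *)
From HB Require Import structures.
From mathcomp Require Import all_boot all_order all_algebra.
From mathcomp Require Import all_fingroup all_solvable all_field all_character.

Set Implicit Arguments.
Unset Strict Implicit.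
Unset Printing Implicit Defensive.

Import Order.TTheory GRing.Theory Num.Theory.
Import GroupScope.
Local Open Scope ring_scope.

(* The group algebra F[G] is the library's [group_ring F G], the span in       *)
(* 'M[F]_#|G| of the matrices [regular_repr F G x], x \in G. A subspace of it  *)
(* is the row space of a matrix B : 'A[F]_#|G|, so dim_F B is \rank B.         *)

(* A block algebra: a nonzero two-sided ideal that is a direct summand of F[G] *)
(* (with an ideal complement) and is indecomposable as a two-sided ideal.      *)
(* [mx_ideal R S] only asserts R * S <= S and S * R <= S; the inclusion of B   *)
(* in F[G] is part of the complement condition.                                *)
Definition is_block (F : fieldType) (gT : finGroupType) (G : {group gT})
    (B : 'A[F]_#|G|) : Prop :=
  let R_G := group_ring F G in
  [/\ mx_ideal R_G B, B != 0,
      exists C : 'A[F]_#|G|,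
        [/\ mx_ideal R_G C, (B + C == R_G)%MS & (B :&: C)%MS = 0]
    & forall B1 B2 : 'A[F]_#|G|,
        mx_ideal R_G B1 -> mx_ideal R_G B2 ->
        (B1 + B2 == B)%MS -> (B1 :&: B2)%MS = 0 -> B1 = 0 \/ B2 = 0].

(* B covers b: the block idempotents satisfy e_b e_B != 0 in F[G]. The         *)
(* embedding F[N] -> F[G] is the linear extension of the restriction to N of   *)
(* the regular representation of G.                                            *)
Definition block_covers (F : fieldType) (gT : finGroupType)
    (G N : {group gT}) (sNG : N \subset G)
    (B : 'A[F]_#|G|) (b : 'A[F]_#|N|) : Prop :=
  exists eB eb, [/\ mxring_id B eB, mxring_id b eb &
    gring_op (subg_repr (regular_repr F G) sNG) eb *m eB != 0].

(* The relative trace Tr_D^G(X) = sum of x^-1 X x, x running over              *)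
(* representatives of the right cosets D x in G.                               *)
Definition rel_trace (F : fieldType) (gT : finGroupType) (G D : {group gT})
    (X : 'M[F]_#|G|) : 'M[F]_#|G| :=
  \sum_(C in rcosets D G)
    regular_repr F G (repr C)^-1%g *m X *m regular_repr F G (repr C).

(* e_B = Tr_D^G(X) for some X in the fixed algebra F[G]^D.                     *)
Definition rel_projective (F : fieldType) (gT : finGroupType)
    (G : {group gT}) (B : 'A[F]_#|G|) (D : {group gT}) : Prop :=
  exists X : 'M[F]_#|G|,
    [/\ (X \in group_ring F G)%MS,
        forall x, x \in D ->
          regular_repr F G x *m X = X *m regular_repr F G x
      & mxring_id B (rel_trace D X)].

(* Defect groups in the sense of Green: the minimal subgroups D of G such that *)
(* e_B is a relative trace from D.                                             *)
Definition is_defect_group (F : fieldType) (gT : finGroupType)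
    (G : {group gT}) (B : 'A[F]_#|G|) (D : {group gT}) : Prop :=
  [/\ D \subset G, rel_projective B D &
      forall H : {group gT}, H \subset D -> rel_projective B H -> H :=: D].

(* The Brauer character of rG, extended by 0 outside the p-regular elements of *)
(* G. With m = |G|_p', zeta is a primitive m-th root of unity in an extension  *)
(* iota : F -> L and omega one in characteristic 0; each eigenvalue zeta ^+ k  *)
(* of rG g is lifted to omega ^+ k and counted with its multiplicity.          *)
Definition brauer_char (p : nat) (F L : fieldType) (iota : {rmorphism F -> L})
    (zeta : L) (omega : algC) (gT : finGroupType) (G : {group gT}) (n : nat)
    (rG : mx_representation F G n) : {ffun gT -> algC} :=
  [ffun g => if (g \in G) && p^'.-elt g then
     \sum_(k < #|G|`_p^')
       (mup (zeta ^+ k) (char_poly (map_mx iota (rG g))))%:R * omega ^+ k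
   else 0].

(* phi is afforded by an irreducible F[G]-module on which e_B acts as identity *)
Definition irr_brauer_in (p : nat) (F L : fieldType) (iota : {rmorphism F -> L})
    (zeta : L) (omega : algC) (gT : finGroupType) (G : {group gT})
    (B : 'A[F]_#|G|) (phi : {ffun gT -> algC}) : Prop :=
  exists n (rG : mx_representation F G n),
    [/\ mx_irreducible rG,
        exists2 eB, mxring_id B eB & gring_op rG eB = 1%:M
      & phi = brauer_char p iota zeta omega rG].

Definition p_solvable (p : nat) (gT : finGroupType) (G : {group gT}) : Prop :=
  let p_factor := fun H K : {set gT} =>
    (H <| K) && (p.-group (K / H) || p^'.-group (K / H)) in
  exists2 s : seq {group gT}, p_factor.-series 1%G s & last 1%G s = G.

(* Main.v *)
Require Import Defs.
From HB Require Import structures.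
From Stdlib Require Import Classical.
From mathcomp Require Import all_boot all_order all_algebra.
From mathcomp Require Import all_fingroup all_solvable all_field all_character.
From mathcomp Require Import zify.

(* Every essential extension of a simple D-projective FN-module S has          *)
(* dimension at most |D| dim S when N is p-solvable. This climbs a series with *)
(* factors of order p or prime to p. Let K be normal in G, S a simple          *)
(* FG-module and M an essential extension of S; by Mackey the simple summands  *)
(* of the restriction of S to K are (D^y :&: K)-projective.                    *)
(* If S is projective relative to a subgroup of K, then the FK-socle of M is S *)
(* itself, because an FK-complement of S in it averages to an FG-complement;   *)
(* so M embeds, over K, in the sum of the hulls of those summands. If G = DK,  *)
(* cut S off by one FK-submodule and intersect its #|G : K| conjugates, using  *)
(* #|G : K| * #|D :&: K| = #|D|.                                               *)
(* The first case, with K = N, gives the bound for the simple modules of B.    *)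
(* The right module B embeds in the sum of the hulls of the summands of its    *)
(* socle, where S occurs at most dim S times, so dim B <= |D| * sum (dim S)^2. *)
(* Finally, non-isomorphic simple modules have distinct Brauer characters,     *)
(* since the latter determine the traces.                                      *)

Set Implicit Arguments.
Unset Strict Implicit.
Unset Printing Implicit Defensive.

Import Order.TTheory GRing.Theory Num.Theory.
Import GroupScope.
Local Open Scope ring_scope.

(** * Sums over cosets *)

(** The estimate multiplies two bounds: an injective hull of a simple module S of B has dimension at
    most |D| dim S, and S occurs at most dim S times in the socle of B. The first holds because e_B,
    a trace from D, acts as the identity on S and so makes S D-projective ([relproj_gring_op]); the
    second because maps from S to F[G] are determined by a linear form on S
    ([regular_isotypic_card]). Hulls are never constructed. [ess_bound] bounds every essential
    extension of S, and [ess_bound_sum] adds these bounds along a socle. [hull_bound_p_solvable]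
    yields the bound over N, using [relproj_normal_summand] to pass relative projectivity down the
    series; [ess_bound_sub_normal] lifts it from N to G since D lies in N. [brauer_char_rsim] lets
    Brauer characters label the simple modules. *)

Section CosetSums.

Variables (gT : finGroupType) (V : nmodType).
Implicit Types (D G K : {group gT}) (phi : gT -> V).

(** This makes a sum over [rcosets D G] independent of the choice of [repr]. *)
Definition left_inv D G phi :=
  forall d x, d \in D -> x \in G -> phi (d * x)%g = phi x.

Lemma repr_rcosets_mem D G C : D \subset G -> C \in rcosets D G -> repr C \in G.
Proof.
move=> sDG /rcosetsP[x Gx ->]; case: (repr_rcosetP D x) => d Dd.
by rewrite groupM // (subsetP sDG).
Qed.

Lemma left_inv_repr D G phi x :
  left_inv D G phi -> x \in G -> phi (repr (D :* x)) = phi x.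
Proof. by move=> phiD Gx; case: (repr_rcosetP D x) => d Dd; rewrite phiD. Qed.

Lemma sum_rcosets_translate D G phi g :
    D \subset G -> left_inv D G phi -> g \in G ->
  \sum_(C in rcosets D G) phi (repr C * g)%g = \sum_(C in rcosets D G) phi (repr C).
Proof.
move=> sDG phiD Gg.
rewrite [RHS](reindex_onto (fun C : {set gT} => C :* g) (fun C => C :* g^-1)).
  apply: eq_big => [C | C /rcosetsP[x Gx ->]].
    rewrite -rcosetM mulgV rcoset1 eqxx andbT.
    apply/idP/idP => /rcosetsP[x Gx].
      by move=> ->; rewrite -rcosetM mem_rcosets mulSGid ?groupM.
    move/(congr1 (fun C : {set gT} => C :* g^-1)); rewrite -!rcosetM mulgV mulg1.
    by move->; rewrite mem_rcosets mulSGid ?groupM ?groupV.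
  rewrite -rcosetM (left_inv_repr phiD) ?groupM //.
  by case: (repr_rcosetP D x) => d Dd; rewrite -mulgA phiD // groupM.
by move=> C _; rewrite -rcosetM mulVg rcoset1.
Qed.

(* Mackey's formula for a normal subgroup K: Y represents the cosets of DK. *)
Lemma sum_rcosets_Mackey D G K phi :
    D \subset G -> K <| G -> left_inv D G phi ->
  exists2 Y : {set gT}, Y \subset G &
    \sum_(C in rcosets D G) phi (repr C) =
    \sum_(y in Y) \sum_(E in rcosets (D :^ y :&: K) K) phi (y * repr E)%g.
Proof.
move=> sDG /andP[sKG nKG] phiD; pose H := (D <*> K)%G.
have sHG : H \subset G by rewrite join_subG sDG.
have defH : H :=: (D * K)%g by rewrite /= norm_joinEl // (subset_trans sDG).
exists [set repr C | C in rcosets H G].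
  by apply/subsetP => _ /imsetP[C HC ->]; apply: repr_rcosets_mem HC.
rewrite (partition_big (fun C => repr (H :* repr C)) [in [set repr C | C in
  rcosets H G]]) /=; last first.
  move=> C CD; apply: imset_f.
  by rewrite mem_rcosets mulSGid ?(repr_rcosets_mem sDG).
apply: eq_bigr => y /imsetP[Cy HCy def_y].
have Gy : y \in G by rewrite def_y (repr_rcosets_mem sHG).
have repy : repr (H :* y) = y.
  rewrite def_y; case/rcosetsP: HCy => x Gx ->.
  by rewrite rcoset_repr.
(* [h] is a bijection from the cosets of [D :^ y :&: K] in [K] to the cosets of [D] contained in
   [D K y]. *)
pose h (E : {set gT}) := D :* (y * repr E).
have injh : {in rcosets (D :^ y :&: K) K &, injective h}.
  move=> E1 E2 /rcosetsP[k1 Kk1 ->] /rcosetsP[k2 Kk2 ->].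
  rewrite /h; case: (repr_rcosetP (D :^ y :&: K) k1) => a1 Ra1.
  case: (repr_rcosetP (D :^ y :&: K) k2) => a2 Ra2 /rcoset_eqP.
  rewrite mem_rcoset => Dyk; apply/rcoset_eqP; rewrite mem_rcoset.
  have /setIP[_ Ka1] := Ra1; have /setIP[_ Ka2] := Ra2.
  have -> : (k1 * k2^-1 = a1^-1 * (a1 * k1 * (k2^-1 * a2^-1)) * a2)%g.
    by rewrite !mulgA mulVg mul1g mulgKV.
  rewrite groupM // groupM ?groupV // inE; apply/andP; split; last first.
    by rewrite !groupM ?groupV.
  by move: Dyk; rewrite mem_conjg conjgE invgK !invMg !mulgA.
have defh E : E \in rcosets (D :^ y :&: K) K -> phi (y * repr E)%g = phi (repr (h E)).
  case/rcosetsP=> k Kk ->; rewrite (left_inv_repr phiD) // groupM //.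
  case: (repr_rcosetP _ k) => a /setIP[_ Ka].
  by rewrite (subsetP sKG) // groupM.
rewrite [RHS](eq_bigr (fun E => phi (repr (h E)))) //.
rewrite -(big_imset (fun C => phi (repr C)) injh) /=.
apply: eq_bigl => C; apply/andP/imsetP =>
  [[/rcosetsP[x Gx ->] /eqP] | [E /rcosetsP[k Kk ->] ->]].
  case: (repr_rcosetP D x) => d Dd defy.
  have: x \in H :* y.
    apply/rcoset_eqP; rewrite -defy rcoset_repr; apply/rcoset_eqP.
    by rewrite mem_rcoset invMg mulKVg groupV (subsetP (joing_subl _ _)).
  rewrite mem_rcoset defH => /mulsgP[d1 k1 Dd1 Kk1 /(canRL (mulgKV _)) defx].
  have Kk : (k1 ^ y)%g \in K by rewrite memJ_norm // (subsetP nKG).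
  exists ((D :^ y :&: K) :* k1 ^ y); first by rewrite mem_rcosets mulSGid ?subsetIr.
  rewrite /h; case: (repr_rcosetP _ (k1 ^ y)%g) => a /setIP[Da _].
  apply/rcoset_eqP; rewrite mem_rcoset defx.
  rewrite mem_conjg conjgE invgK mulgA in Da.
  have -> : (d1 * k1 * y * (y * (a * k1 ^ y))^-1 = d1 * (y * a * y^-1)^-1)%g.
    by rewrite conjgE !invMg !invgK !mulgA !mulgK.
  by rewrite groupM ?groupV.
rewrite /h; case: (repr_rcosetP _ k) => a /setIP[_ Ka].
have Gyak : (y * (a * k))%g \in G by rewrite groupM // (subsetP sKG) // groupM.
split; first by rewrite mem_rcosets mulSGid.
case: (repr_rcosetP D (y * (a * k))) => d Dd.
rewrite -[X in _ == X]repy; apply/eqP; congr (repr _); apply/rcoset_eqP.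
rewrite mem_rcoset -mulgA; apply: groupM; first exact: (subsetP (joing_subl _ _)).
apply: (subsetP (joing_subr _ _)).
have -> : (y * (a * k) * y^-1 = (a * k) ^ y^-1)%g by rewrite conjgE invgK !mulgA.
by rewrite memJ_norm ?groupM // groupV (subsetP nKG).
Qed.

End CosetSums.

(** * Relative traces and relative projectivity *)

Section RelativeTrace.

Variables (F : fieldType) (gT : finGroupType).
Implicit Types (D G K : {group gT}).

(** With plain functions for [r1] and [r2], a representation of [G] serves over every subgroup
    without being restricted. *)
Definition mxhom (H : {set gT}) m n (r1 : gT -> 'M[F]_m) (r2 : gT -> 'M[F]_n)
    (f : 'M[F]_(m, n)) :=
  forall x, x \in H -> r1 x *m f = f *m r2 x.

Lemma mxhomS (H1 H2 : {set gT}) m n (r1 : gT -> 'M_m) (r2 : gT -> 'M_n) f :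
  H1 \subset H2 -> mxhom H2 r1 r2 f -> mxhom H1 r1 r2 f.
Proof. by move=> sH12 homf x /(subsetP sH12)/homf. Qed.

Lemma mxhomM (H : {set gT}) m n k (r1 : gT -> 'M_m) (r2 : gT -> 'M_n)
    (r3 : gT -> 'M_k) f g :
  mxhom H r1 r2 f -> mxhom H r2 r3 g -> mxhom H r1 r3 (f *m g).
Proof. by move=> homf homg x Hx; rewrite mulmxA homf // -!mulmxA homg. Qed.

Definition conj_hom m n (r1 : gT -> 'M_m) (r2 : gT -> 'M_n) (f : 'M[F]_(m, n)) x :=
  r1 x^-1%g *m f *m r2 x.

Definition hom_trace G D m n (r1 : gT -> 'M_m) (r2 : gT -> 'M_n)
    (f : 'M[F]_(m, n)) :=
  \sum_(C in rcosets D G) conj_hom r1 r2 f (repr C).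

Lemma conj_hom_inv G D m n (r1 : mx_representation F G m)
    (r2 : mx_representation F G n) f :
  D \subset G -> mxhom D r1 r2 f -> left_inv D G (conj_hom r1 r2 f).
Proof.
move=> sDG homf d x Dd Gx; have Gd := subsetP sDG d Dd.
rewrite /conj_hom invMg !repr_mxM ?groupV //.
rewrite -!mulmxA (mulmxA f) -homf // !mulmxA; congr (_ *m _ *m _).
by rewrite -mulmxA -repr_mxM ?groupV // mulVg repr_mx1 mulmx1.
Qed.

Lemma hom_trace_hom G D m n (r1 : mx_representation F G m)
    (r2 : mx_representation F G n) f :
  D \subset G -> mxhom D r1 r2 f -> mxhom G r1 r2 (hom_trace G D r1 r2 f).
Proof.
move=> sDG homf g Gg; rewrite /hom_trace.
rewrite -{1}(sum_rcosets_translate sDG (conj_hom_inv sDG homf) Gg).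
rewrite mulmx_sumr mulmx_suml; apply: eq_bigr => C /(repr_rcosets_mem sDG) Gx.
rewrite /conj_hom invMg !repr_mxM ?groupV // !mulmxA.
by rewrite -repr_mxM ?groupV // mulgV repr_mx1 mul1mx.
Qed.

Lemma hom_traceMl G D k m n (r0 : gT -> 'M_k) (r1 : mx_representation F G m)
    (r2 : gT -> 'M_n) h f :
  D \subset G -> mxhom G r0 r1 h ->
  h *m hom_trace G D r1 r2 f = hom_trace G D r0 r2 (h *m f).
Proof.
move=> sDG homh; rewrite mulmx_sumr; apply: eq_bigr => C CD.
have Gx := repr_rcosets_mem sDG CD.
by rewrite /conj_hom !mulmxA homh ?groupV.
Qed.

Lemma hom_traceMr G D k m n (r0 : gT -> 'M_k) (r1 : mx_representation F G m)
    (r2 : gT -> 'M_n) h f :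
  D \subset G -> mxhom G r1 r2 h ->
  hom_trace G D r0 r1 f *m h = hom_trace G D r0 r2 (f *m h).
Proof.
move=> sDG homh; rewrite mulmx_suml; apply: eq_bigr => C CD.
have Gx := repr_rcosets_mem sDG CD.
by rewrite /conj_hom -!mulmxA homh.
Qed.

(* Higman's criterion is taken as the definition of relative projectivity. *)
Definition relproj G D n (rG : gT -> 'M[F]_n) :=
  exists2 theta, mxhom D rG rG theta & hom_trace G D rG rG theta = 1%:M.

(** A retraction over [D] is averaged with [theta]: f Tr(r theta) = Tr(f r theta) = Tr(theta) =
    1. *)
Lemma relproj_split G D m n (rS : mx_representation F G m)
    (rM : mx_representation F G n) f r :
    D \subset G -> relproj G D rS -> mxhom G rS rM f -> mxhom D rM rS r ->
    f *m r = 1%:M ->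
  exists2 r', mxhom G rM rS r' & f *m r' = 1%:M.
Proof.
move=> sDG [theta homth tr1] homf homr fr1.
exists (hom_trace G D rM rS (r *m theta)).
  by apply: hom_trace_hom => //; apply: mxhomM homth.
by rewrite (hom_traceMl _ _ sDG homf) mulmxA fr1 mul1mx.
Qed.

(** Mackey's formula writes 1 = i Tr(theta) r as a sum of traces from the [D :^ y :&: K] to [K].
    Some summand is nonzero, hence invertible by Schur's lemma, and dividing by it gives Higman's
    criterion for [rT]. *)
Lemma relproj_normal_summand G D K m n (nKG : K <| G) (rS : mx_representation F G m)
    (rT : mx_representation F K n) i r :
    D \subset G -> relproj G D rS -> mx_irreducible rT ->
    mxhom K rT rS i -> mxhom K rS rT r -> i *m r = 1%:M ->
  exists2 y, y \in G & relproj K (D :^ y :&: K)%G rT.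
Proof.
move=> sDG [theta homth tr1] irrT homi homr ir1.
have sKG := normal_sub nKG; have Dinv := conj_hom_inv sDG homth.
pose psi x := i *m conj_hom rS rS theta x *m r.
have psiD : left_inv D G psi by move=> d x Dd Gx; rewrite /psi Dinv.
have [Y sYG defsum] := sum_rcosets_Mackey sDG nKG psiD.
have sum1 : \sum_(C in rcosets D G) psi (repr C) = 1%:M.
  by rewrite -mulmx_suml -mulmx_sumr [X in _ *m X *m _]tr1 mulmx1.
pose al y := i *m conj_hom rS rS theta y *m r.
have homal y : y \in G -> mxhom (D :^ y :&: K) rT rT (al y).
  move=> Gy x /setIP[Dx Kx]; have Gx := subsetP sKG x Kx.
  rewrite /al !mulmxA homi // -!mulmxA -homr // !mulmxA; congr (_ *m r).
  rewrite -!mulmxA; congr (i *m _); rewrite /conj_hom.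
  rewrite mem_conjg in Dx; have Gxy := subsetP sDG _ Dx.
  rewrite !mulmxA -repr_mxM ?groupV //.
  have -> : (x * y^-1 = y^-1 * (x ^ y^-1))%g by rewrite conjgE invgK !mulgA mulVg
    mul1g.
  rewrite repr_mxM ?groupV // -(mulmxA _ _ theta) homth // -!mulmxA;
    congr (_ *m (_ *m _)).
  by rewrite -!repr_mxM // conjgE invgK -!mulgA mulVg mulg1.
have inner y : y \in Y -> \sum_(E in rcosets (D :^ y :&: K) K) psi (y * repr E)%g
    = hom_trace K (D :^ y :&: K)%G rT rT (al y).
  move=> /(subsetP sYG) Gy; apply: eq_bigr => E EK.
  have Kk : repr E \in K by apply: (repr_rcosets_mem (D := (D :^ y :&: K)%G)) EK;
    apply: subsetIr.
  have Gk := subsetP sKG _ Kk.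
  rewrite /psi /al /conj_hom invMg !repr_mxM ?groupV // !mulmxA.
  by rewrite homi ?groupV // -!mulmxA homr.
have [y Yy nz] : exists2 y, y \in Y & hom_trace K (D :^ y :&: K)%G rT rT (al y) != 0.
  apply/exists_inP; apply: contraTT isT => /exists_inPn allz.
  move: sum1; rewrite defsum big1 => [/esym/eqP|y Yy].
    by case/mx_irrP: irrT => n_gt0 _; rewrite -mxrank_eq0 mxrank1 -(subnKC n_gt0).
  by rewrite inner //; apply/eqP; move: (allz y Yy); rewrite negbK.
have Gy := subsetP sYG y Yy; exists y => //.
have sDK : (D :^ y :&: K)%G \subset K by apply: subsetIr.
have homt := hom_trace_hom sDK (homal y Gy).
set t := hom_trace _ _ _ _ _ in nz homt.
have ut : t \in unitmx.
  by apply: (mx_Schur irrT) => //; apply/centgmxP => x Kx; rewrite homt.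
have homt' : mxhom K rT rT (invmx t).
  move=> x Kx; apply: (can_inj (mulmxK ut)); rewrite mulmxKV // -[RHS]mulmxA homt //.
  by rewrite mulKmx.
exists (al y *m invmx t).
  by apply: mxhomM (homal y Gy) _; apply: mxhomS homt'; apply: subsetIr.
by rewrite -(hom_traceMr _ _ sDK homt') mulmxV.
Qed.

End RelativeTrace.

(** * Essential extensions *)

Section EssentialExtensions.

Variable F : fieldType.

Lemma leq_codim_bigcap n (I : finType) (A : {pred I}) (U : I -> 'M[F]_n)
    (c : I -> nat) :
    (forall i, i \in A -> n <= \rank (U i) + c i)%N ->
  (n <= \rank (\bigcap_(i in A) U i)%MS + \sum_(i in A) c i)%N.
Proof.
move=> Uc.
elim/big_rec2: _ => [|i V s Ai IH]; first by rewrite mxrank1 addn0.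
have := mxrank_sum_cap (U i) V; have := rank_leq_row (U i + V)%MS.
have := Uc i Ai; lia.
Qed.

Variable gT : finGroupType.
Implicit Types (D G K : {group gT}).

Definition essential G d n (rM : mx_representation F G n) (f : 'M[F]_(d, n)) :=
  forall U : 'M_n, mxmodule rM U -> (U :&: f)%MS = 0 -> U = 0.

(** Stands for an injective hull of dimension at most [c], without any hull being built. *)
Definition ess_bound G d (rS : mx_representation F G d) c :=
  forall n (rM : mx_representation F G n) f,
    mxhom G rS rM f -> row_free f -> essential rM f -> (n <= c)%N.

(** Let [U] be maximal among the submodules containing [U0] and missing the image of [f]. Then S
    stays essential in the quotient by [U], whose dimension is therefore at most [c]. *)
Lemma ess_bound_cut G d (rS : mx_representation F G d) c n
    (rM : mx_representation F G n) (f : 'M_(d, n)) (U0 : 'M_n) :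
    ess_bound rS c -> mxhom G rS rM f -> row_free f ->
    mxmodule rM U0 -> (U0 :&: f)%MS = 0 ->
  exists U : 'M_n, [/\ mxmodule rM U, (U0 <= U)%MS, (U :&: f)%MS = 0 &
    (n <= \rank U + c)%N].
Proof.
move=> bS homf freef; have [m] := ubnP (n - \rank U0)%N.
elim: m U0 => // m IH U0 ltm modU0 tiU0.
case: (classic (exists U : 'M_n, [/\ mxmodule rM U, (U0 <= U)%MS, (U :&: f)%MS = 0 &
    (\rank U0 < \rank U)%N])) => [[U [modU sU0U tiU ltU]] | maxU].
  have leU := rank_leq_row U.
  have [|//|//|U' [modU' sUU' tiU' leU']] := IH U; first by lia.
  by exists U'; split=> //; apply: submx_trans sU0U sUU'.
exists U0; split=> //.
rewrite -leq_subLR -mxrank_coker; apply: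
  (bS _ (factmod_repr modU0) (in_factmod U0 f)).
- move=> x Gx; rewrite -[RHS](in_factmodJ modU0) // -homf //.
  by rewrite /in_factmod /= mulmxA.
- rewrite /row_free -(eqn_add2r (\rank U0)) mxrank_in_factmod.
  by rewrite mxrank_disjoint_sum // addnC (eqP freef).
move=> X modX tiX.
(* The preimage of [X] still misses the image of [f], so by maximality it is [U0], and [X]
   vanishes. *)
pose U := (U0 + val_factmod X)%MS.
have modU : mxmodule rM U by rewrite /U val_factmod_module.
have inU : (in_factmod U0 U :=: X)%MS.
  by apply: eqmx_trans (in_factmod_addsK _ _) _; rewrite val_factmodK.
have tiU : (U :&: f)%MS = 0.
  apply/eqP/rowV0P => v; rewrite sub_capmx => /andP[vU vf].
  have : (in_factmod U0 v <= X :&: in_factmod U0 f)%MS.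
    by rewrite sub_capmx -inU !submxMr.
  rewrite tiX submx0 in_factmod_eq0 => vU0; apply/eqP.
  by rewrite -submx0 -tiU0 sub_capmx vU0.
have leU : ~~ (\rank U0 < \rank U)%N.
  by apply/negP => ltU; apply: maxU; exists U; rewrite addsmxSl.
have sU : (U <= U0)%MS.
  by rewrite -(geq_leqif (mxrank_leqif_sup (addsmxSl _ _))) leqNgt.
apply/eqP; rewrite -(val_factmodK X) in_factmod_eq0.
by apply: submx_trans (addsmxSr _ _) sU.
Qed.

Lemma val_submod_hom G n (rM : mx_representation F G n) (W : 'M_n)
  (modW : mxmodule rM W) : mxhom G (submod_repr modW) rM (val_submod 1%:M).
Proof. by move=> x Gx; rewrite -val_submodJ // mul1mx [RHS]val_submodE. Qed.

Lemma val_submod_free n (W : 'M[F]_n) : row_free (@val_submod F n W _ 1%:M).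
Proof. by rewrite /row_free val_submod1. Qed.

(** For each i, cut off [W i] by a submodule [U i] of codimension at most [c i] containing all the
    other [W j]. The intersection of the [U i] contains no simple submodule, so it is zero. *)
Lemma ess_bound_sum G n (rM : mx_representation F G n) (I : finType)
    (W : I -> 'M_n) (c : I -> nat) (simW : forall i, mxsimple rM (W i)) :
    mxdirect (\sum_i W i) ->
    (forall i, ess_bound (submod_repr (mxsimple_module (simW i))) (c i)) ->
    (forall X, mxsimple rM X -> (X <= \sum_i W i)%MS) ->
  (n <= \sum_i c i)%N.
Proof.
move=> /mxdirect_sumsP dxW bW socM.
have cut i : exists U : 'M_n, [/\ mxmodule rM U, (\sum_(j | j != i) W j <= U)%MS,
    (U :&: W i)%MS = 0 & (n <= \rank U + c i)%N].
  have modS : mxmodule rM (\sum_(j | j != i) W j)%MS.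
    by apply: sumsmx_module => j _; case: (simW j).
  have tiS : ((\sum_(j | j != i) W j) :&: val_submod (1%:M :
    'M_(\rank (W i))))%MS = 0.
    apply/eqP; rewrite -submx0 -[X in (_ <= X)%MS](dxW i isT) sub_capmx capmxSl andbT.
    by rewrite -(val_submod1 (W i)) capmxSr.
  have [U [modU sU tiU leU]] := ess_bound_cut (bW i) (val_submod_hom _)
    (val_submod_free _) modS tiS.
  exists U; split=> //; apply/eqP; rewrite -submx0 -tiU sub_capmx capmxSl.
  by rewrite val_submod1 capmxSr.
have [U /all_and4[modU sWU tiU leU]] := fin_all_exists cut.
have := @leq_codim_bigcap _ _ predT U c (fun i _ => leU i).
suff -> : (\bigcap_(i in predT) U i)%MS = 0 by rewrite mxrank0.
have modcap : mxmodule rM (\bigcap_(i in predT) U i)%MS by apply: bigcapmx_module.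
apply/eqP; apply/idPn => nz; suff: false by [].
apply: (mxsimple_exists modcap nz) => -[X simX sXU].
have [_ nzX _] := simX; case/negP: nzX; rewrite -submx0.
(* The summands are dropped one at a time: [X] lies in [U i], which contains the remaining ones and
   misses [W i], so the modular law applies. *)
suff descend r : uniq r -> (X <= \sum_(i <- r) W i)%MS -> (X <= (0 : 'M_n))%MS.
  by apply: (descend (index_enum I)); [exact: index_enum_uniq | exact: socM].
elim: r => [|i r IH] /=; first by rewrite big_nil.
case/andP=> ir ur; rewrite big_cons => sX; apply: IH => //.
have sS : (\sum_(j <- r) W j <= U i)%MS.
  apply: submx_trans (sWU i); rewrite big_seq; elim/big_rec: _ => [|j V jr sV].
    exact: sub0mx.
  rewrite addsmx_sub sV andbT (sumsmx_sup j) //.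
  by apply: contraNneq ir => <-.
have sXi : (X <= U i)%MS by apply: submx_trans sXU _; apply: (bigcapmx_inf i).
have : (X <= (W i + \sum_(j <- r) W j) :&: U i)%MS by rewrite sub_capmx sX.
by rewrite addsmxC -(matrix_modl _ sS) capmxC tiU addsmx0_id.
Qed.

End EssentialExtensions.

(** * Restriction to a normal subgroup *)

Section NormalSubgroup.

Variables (F : fieldType) (gT : finGroupType) (G K : {group gT}).
Hypothesis nsKG : K <| G.
Let sKG := normal_sub nsKG.

(** Clifford: the [G]-translates of one simple [K]-submodule are simple and span [V]. The result is
    [classically] qualified because such a submodule is only found classically. *)
Lemma subg_semisimple n (rG : mx_representation F G n) (V : 'M_n) :
  mxsimple rG V -> classically (mxsemisimple (subg_repr rG sKG) V).
Proof.
move=> [modV nzV simV] b nssV.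
have modVK : mxmodule (subg_repr rG sKG) V.
  by apply/mxmoduleP => x Kx; apply: (mxmoduleP modV); apply: (subsetP sKG).
apply: (mxsimple_exists modVK nzV) => -[W simW sWV]; apply: nssV.
pose S := (\sum_(x in G) W *m rG x)%MS.
have modS : mxmodule rG S.
  apply/mxmoduleP => y Gy; rewrite sumsmxMr; apply/sumsmx_subP => x Gx.
  by rewrite -mulmxA -repr_mxM // (sumsmx_sup (x * y)%g) ?groupM.
have sSV : (S <= V)%MS.
  by apply/sumsmx_subP => x Gx; rewrite (mxmodule_trans modV).
have nzS : S != 0.
  have [_ nzW _] := simW; apply: contraNneq nzW => S0.
  by rewrite -submx0 -S0 (sumsmx_sup 1%g) // repr_mx1 mulmx1.
apply: (eqmx_semisimple (U := S)).
  by apply/eqmxP; rewrite sSV simV.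
by apply: sumsmx_semisimple => x Gx; apply/mxsimple_semisimple/Clifford_simple.
Qed.

Section Embedding.

Variables (d n : nat) (rS : mx_representation F G d) (rM : mx_representation F G n).
Variable f : 'M[F]_(d, n).
Hypotheses (homf : mxhom G rS rM f) (freef : row_free f).

Lemma pinvmx_hom m (A : 'M_(m, n)) x :
  x \in G -> (A <= f)%MS -> A *m rM x *m pinvmx f = A *m pinvmx f *m rS x.
Proof.
move=> Gx sAf; apply: (row_free_inj freef).
rewrite -[RHS]mulmxA homf // mulmxA !mulmxKpV //.
by case/submxP: sAf => B ->; rewrite -mulmxA -homf // mulmxA submxMl.
Qed.

Lemma embedding_simple : mx_irreducible rS -> mxsimple rM <<f>>%MS.
Proof.
case/mx_irrP => d_gt0 irrS; split.
- rewrite (eqmx_module _ (genmxE f)); apply/mxmoduleP => x Gx.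
  by rewrite -homf // submxMl.
- by rewrite -mxrank_eq0 genmxE (eqP freef) -lt0n.
move=> U modU; rewrite !genmxE => sUf nzU.
have defU : (<<U *m pinvmx f>> *m f :=: U)%MS.
  by apply: eqmx_trans (eqmxMr f (genmxE _)) _; rewrite mulmxKpV.
have : row_full <<U *m pinvmx f>>%MS.
  apply: irrS; last by apply: contraNneq nzU => E;
    rewrite -submx0 -defU E mul0mx sub0mx.
  rewrite (eqmx_module _ (genmxE _)); apply/mxmoduleP => x Gx.
  by rewrite -pinvmx_hom // submxMr // (mxmoduleP modU).
by rewrite -sub1mx => /(submxMr f); rewrite mul1mx defU.
Qed.

(** Projection along a [K]-complement of [W] in the image of [f] supplies the retraction that
    [relproj_normal_summand] requires. *)
Lemma embedding_summand_relproj (D : {group gT}) (W : 'M_n) (modW :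
  mxmodule (subg_repr rM sKG) W) :
    D \subset G -> relproj G D rS -> mxsemisimple (subg_repr rM sKG) <<f>>%MS ->
    mxsimple (subg_repr rM sKG) W -> (W <= f)%MS ->
  exists2 y, y \in G & relproj K (D :^ y :&: K)%G (submod_repr modW).
Proof.
move=> sDG prS ssf simW sWf.
have [|R modR defR dxR] := mxsemisimple_reducible ssf modW; first by rewrite genmxE.
have tiR := mxdirect_addsP dxR.
have valf : (@val_submod F n W _ 1%:M <= f)%MS by rewrite val_submod1.
apply: (@relproj_normal_summand _ _ G D K _ _ nsKG rS (submod_repr modW)
  (val_submod 1%:M *m pinvmx f) (f *m proj_mx W R *m in_submod W 1%:M)) => //.
- exact/submod_mx_irr.
- move=> x Kx; rewrite -[RHS]pinvmx_hom ?(subsetP sKG) //.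
  by rewrite mulmxA (val_submod_hom modW).
- move=> x Kx; have Gx := subsetP sKG x Kx.
  have homP : f *m rM x *m proj_mx W R = f *m proj_mx W R *m rM x.
    have /hom_mxP/(_ x Kx) // : (f <= dom_hom_mx (subg_repr rM sKG) (proj_mx W R))%MS.
    by apply: submx_trans (proj_mx_hom tiR modW modR); rewrite defR genmxE.
  have := in_submodJ modW x (proj_mx_sub W R f); rewrite /= -homP.
  rewrite in_submodE [in_submod W (_ *m _)]in_submodE => homJ.
  by rewrite -[RHS]homJ -homf // !mulmxA.
rewrite -(mulmxA f) (mulmxA _ f) mulmxKpV // (mulmxA (val_submod _)).
rewrite proj_mx_id ?val_submodP //.
by rewrite -in_submodE val_submodK.
Qed.

(* A K-equivariant retraction onto S averages to a G-equivariant one, whose    *)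
(* kernel must vanish in an essential extension.                               *)
Lemma essential_socle (D : {group gT}) (X : 'M_n) :
    D \subset K -> relproj G D rS -> mx_irreducible rS -> essential rM f ->
  mxsimple (subg_repr rM sKG) X -> (X <= f)%MS.
Proof.
move=> sDK prS irrS essf simX; have simf := embedding_simple irrS.
have [modf _ _] := simf.
pose V := (<<f>> + \sum_(x in G) X *m rM x)%MS.
apply: (subg_semisimple simf) => ssf.
have ssV : mxsemisimple (subg_repr rM sKG) V.
  apply: addsmx_semisimple => //; apply: sumsmx_semisimple => x Gx.
  exact/mxsimple_semisimple/Clifford_simple.
have modV : mxmodule rM V.
  apply: addsmx_module => //; apply/mxmoduleP => y Gy; rewrite sumsmxMr.
  apply/sumsmx_subP => x Gx.
  by rewrite -mulmxA -repr_mxM // (sumsmx_sup (x * y)%g) ?groupM.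
have sfV : (f <= V)%MS by rewrite -(genmxE f) addsmxSl.
have modfK := mxsemisimple_module ssf.
have [|R modR defR dxR] := mxsemisimple_reducible ssV modfK; first exact: addsmxSl.
have tiR := mxdirect_addsP dxR.
pose r0 := val_submod 1%:M *m proj_mx <<f>>%MS R *m pinvmx f : 'M_(\rank V, d).
have [|||r' homr' fr'] := @relproj_split _ _ G D _ _ rS (submod_repr modV)
    (in_submod V f) r0 (subset_trans sDK sKG) prS.
- by move=> x Gx; rewrite -[RHS](in_submodJ modV) // -homf // [RHS]in_submodE
  (in_submodE V f) mulmxA.
- move=> x Dx; have Kx := subsetP sDK x Dx; have Gx := subsetP sKG x Kx.
  have homP : val_submod 1%:M *m rM x *m proj_mx <<f>>%MS R
      = val_submod (1%:M : 'M_(\rank V)) *m proj_mx <<f>>%MS R *m rM x.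
    have /hom_mxP/(_ x Kx) // : (val_submod (1%:M : 'M_(\rank V))
        <= dom_hom_mx (subg_repr rM sKG) (proj_mx <<f>>%MS R))%MS.
    by apply: submx_trans (proj_mx_hom tiR modfK modR); rewrite defR val_submodP.
  rewrite /r0 -pinvmx_hom //; last by rewrite -(genmxE f) proj_mx_sub.
  rewrite -homP -(val_submod_hom modV) //.
  by rewrite !(mulmxA (submod_repr modV x)).
- rewrite /r0 -(mulmxA (val_submod _)) mulmxA -val_submodE in_submodK // mulmxA.
  by rewrite proj_mx_id ?genmxE // mulmxVp.
(* The kernel of the averaged retraction is a [G]-submodule missing the image of [f]. Once it is
   zero, comparing ranks gives that [V] is the image of [f]. *)
have : <<val_submod (kermx r')>>%MS = 0.
  apply: essf.
    rewrite (eqmx_module _ (genmxE _)) (val_submod_module modV).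
    apply/mxmoduleP => x Gx; apply/sub_kermxP.
    by rewrite -mulmxA homr' // mulmxA mulmx_ker mul0mx.
  apply/eqP/rowV0P => v; rewrite sub_capmx genmxE =>
    /andP[/submxP[u ->] /submxP[a defa]].
  have : u *m kermx r' = a *m in_submod V f.
    apply: (@val_submod_inj _ _ V); rewrite val_submodE -mulmxA -val_submodE defa.
    by rewrite [RHS]val_submodE -mulmxA -val_submodE in_submodK.
  move/(congr1 (mulmxr r')) => /=; rewrite -(mulmxA u) -(mulmxA a) mulmx_ker fr'
    mulmx0 mulmx1 => a0.
  by rewrite defa -a0 mul0mx.
move/eqP; rewrite (eqmx_eq0 (genmxE _)) val_submod_eq0 kermx_eq0 => /eqP rk.
have leV : (\rank V <= \rank f)%N by rewrite -rk (eqP freef) rank_leq_col.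
have sVf : (V <= f)%MS by rewrite -(geq_leqif (mxrank_leqif_sup sfV)).
apply: submx_trans sVf; apply: submx_trans (addsmxSr _ _).
by rewrite (sumsmx_sup 1%g) // repr_mx1 mulmx1.
Qed.

End Embedding.

End NormalSubgroup.

(** * Injective hulls over p-solvable groups *)

Section HullBound.

Variables (F : fieldType) (gT : finGroupType).
Implicit Types (D G K : {group gT}).

(* An essential extension of S embeds in its injective hull, which is also its *)
(* projective cover; so this bounds the dimension of the latter.               *)
Definition hull_bound G :=
  forall D t (rT : mx_representation F G t), D \subset G ->
    mx_irreducible rT -> relproj G D rT -> ess_bound rT (#|D| * t)%N.

Lemma ess_boundW G d (rS : mx_representation F G d) c1 c2 :
  (c1 <= c2)%N -> ess_bound rS c1 -> ess_bound rS c2.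
Proof.
by move=> lec b1 n rM f homf freef essf; apply: leq_trans lec; apply: b1 essf.
Qed.

(** The two subgroups have separate tasks: [D'] inside [K] forces the [K]-socle of an extension to
    be S, while [D] enters the dimension bound through |D^y ∩ K| <= |D|. *)
Lemma ess_bound_sub_normal G K D D' d (rS : mx_representation F G d) :
    K <| G -> hull_bound K -> D \subset G -> D' \subset K -> mx_irreducible rS ->
  relproj G D rS -> relproj G D' rS -> ess_bound rS (#|D| * d)%N.
Proof.
move=> nsKG bK sDG sD'K irrS prD prD' n rM f homf freef essf.
pose rK := subg_repr rM (normal_sub nsKG).
have simf := embedding_simple homf freef irrS.
apply: (subg_semisimple (nsKG := nsKG) simf) => ssf.
have [I W /= simW defW dxW] := ssf.
have sWf i : (W i <= f)%MS by rewrite -(genmxE f) -defW (sumsmx_sup i).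
suff : (n <= \sum_i #|D| * \rank (W i))%N.
  by rewrite -big_distrr /= -(mxdirectP dxW) /= defW genmxE (eqP freef).
apply: (ess_bound_sum (rM := rK) (simW := simW)) => // [i|X simX].
  have [y Gy prW] := embedding_summand_relproj homf freef
    (mxsimple_module (simW i)) sDG prD ssf (simW i) (sWf i).
  apply: ess_boundW (bK _ _ _ _ _ prW); rewrite ?subsetIr //.
    by rewrite leq_mul2r -(cardJg D y) subset_leq_card ?orbT ?subsetIl.
  exact/submod_mx_irr.
rewrite defW genmxE.
exact: (essential_socle homf freef sD'K prD' irrS essf simX).
Qed.

(** A [K]-submodule [U1] missing a simple [W] in S has codimension at most |D ∩ K| dim W. The
    intersection of its |G : K| translates is a [G]-submodule not containing S, hence zero by
    essentiality. *)
Lemma ess_bound_normal_cover G K D d (rS : mx_representation F G d) :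
    K <| G -> hull_bound K -> D \subset G -> (D * K)%g = G -> mx_irreducible rS ->
  relproj G D rS -> ess_bound rS (#|D| * d)%N.
Proof.
move=> nsKG bK sDG defG irrS prD n rM f homf freef essf.
have sKG := normal_sub nsKG; pose rK := subg_repr rM sKG.
have simf := embedding_simple homf freef irrS.
apply: (subg_semisimple (nsKG := nsKG) simf) => ssf.
have [modf nzf _] := simf.
apply: (mxsimple_exists (mxsemisimple_module ssf) nzf) => -[W simW].
rewrite genmxE => sWf; have modW := mxsimple_module simW.
have [|R modR defR dxR] := mxsemisimple_reducible ssf modW; first by rewrite genmxE.
have [y Gy prW] := embedding_summand_relproj homf freef modW sDG prD ssf simW sWf.
have bW : ess_bound (submod_repr modW) (#|(D :^ y :&: K)%G| * \rank W)%N.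
  by apply: bK prW; [apply: subsetIr | apply/submod_mx_irr].
have tiR : (R :&: val_submod (1%:M : 'M_(\rank W)))%MS = 0.
  apply/eqP; rewrite -submx0 -(mxdirect_addsP dxR) sub_capmx capmxSl andbT.
  by rewrite -(val_submod1 W) capmxSr.
have [U1 [modU1 sRU1 tiU1 leU1]] :=
  ess_bound_cut bW (val_submod_hom modW) (val_submod_free W) modR tiR.
pose U := (\bigcap_(C in rcosets K G) (U1 *m rM (repr C)))%MS.
have modU : mxmodule rM U.
  apply/mxmoduleP => g Gg; apply/sub_bigcapmxP => C CK.
  have Gx := repr_rcosets_mem sKG CK.
  have CK' : C :* g^-1 \in rcosets K G.
    case/rcosetsP: CK => x Gx' ->.
    by rewrite -rcosetM mem_rcosets mulSGid ?groupM ?groupV.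
  apply: submx_trans (submxMr _ (bigcapmx_inf _ CK' (submx_refl _))) _.
  have Gx' := repr_rcosets_mem sKG CK'.
  have defC : K :* repr C = C by case/rcosetsP: CK => x _ ->; apply: rcoset_repr.
  (* Translation by [g] permutes the translates of [U1]; a change of representative is harmless
     because [U1] is [K]-stable. *)
  have : (repr (C :* g^-1) * g)%g \in K :* repr C.
    rewrite defC.
    have : repr (C :* g^-1) \in C :* g^-1.
      by case/rcosetsP: CK' => x _ ->; apply: mem_repr_rcoset.
    by rewrite mem_rcoset invgK.
  case/rcosetP => k Kk defk.
  rewrite -mulmxA -repr_mxM // defk (repr_mxM _ (subsetP sKG k Kk) Gx) mulmxA
    submxMr //.
  exact: (mxmoduleP modU1).
have U0 : U = 0.
  apply: essf => //; apply/eqP; apply: contraT => nzUf.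
  have [_ _ simf'] := simf; have [_ nzW _] := simW.
  have sfUf : (<<f>> <= <<U :&: f>>)%MS.
    apply: simf'; rewrite ?genmxE ?capmxSr ?(eqmx_module _ (genmxE _)) //.
      apply: capmx_module => //.
      by rewrite -(eqmx_module _ (genmxE f)).
    by rewrite (eqmx_eq0 (genmxE _)).
  rewrite !genmxE in sfUf.
  have sWU1 : (W <= U1)%MS.
    apply: submx_trans (submx_trans sWf sfUf) (submx_trans (capmxSl _ _) _).
    have KK : (K : {set gT}) \in rcosets K G.
      by apply/rcosetsP; exists 1%g; rewrite ?rcoset1.
    apply: (bigcapmx_inf _ KK); rewrite repr_group repr_mx1 mulmx1.
    exact: submx_refl.
  case/negP: nzW; rewrite -submx0 -tiU1 sub_capmx sWU1.
  by rewrite val_submod1 submx_refl.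
have := @leq_codim_bigcap F n _ [in rcosets K G] (fun C => U1 *m rM (repr C))
  (fun=> (#|(D :^ y :&: K)%G| * \rank W)%N).
rewrite -/U U0 mxrank0 add0n sum_nat_const => le_n.
have {le_n} le_n : (n <= #|G : K| * (#|(D :^ y :&: K)%G| * \rank W))%N.
  apply: le_n => C CK; have Gx := repr_rcosets_mem sKG CK.
  by rewrite mxrankMfree // row_free_unit repr_mx_unit.
apply: leq_trans le_n _; rewrite mulnA leq_mul //; last first.
  by rewrite -(eqP freef) mxrankS.
have -> : #|(D :^ y :&: K)%G| = #|D :&: K|.
  by rewrite /= -{1}(normsP (normal_norm nsKG) y Gy) -conjIg cardJg.
rewrite -(leq_pmul2r (cardG_gt0 K)) -mulnA (mulnC _ #|K|) mulnA.
by rewrite (mulnC _ #|K|) (Lagrange sKG) mul_cardG defG.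
Qed.

(** Over the trivial group every subspace is a submodule, so an essential extension of S is S
    itself. *)
Lemma hull_bound1 : hull_bound 1%G.
Proof.
move=> D t rT sD1 irrT prT n rM f homf freef essf.
suff f0 : (f^C)%MS = 0.
  have := mxrank_compl f; rewrite f0 mxrank0 (eqP freef).
  by have := cardG_gt0 D; have := rank_leq_col f; rewrite (eqP freef); nia.
apply: essf; last by rewrite capmxC capmx_compl.
by apply/mxmoduleP => x /set1P ->; rewrite repr_mx1 mulmx1.
Qed.

(** The scalar |G : K|^-1 exists in [F] and has trace 1, so every module is [K]-projective and
    [D' := K] is allowed. *)
Lemma hull_bound_p'quotient (p : nat) G K :
  p \in [pchar F] -> K <| G -> p^'.-group (G / K)%g -> hull_bound K -> hull_bound G.
Proof.
move=> pcharF nsKG p'GK bK D d rS sDG irrS prS.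
apply: (ess_bound_sub_normal (D' := K) nsKG bK sDG) => //.
have sKG := normal_sub nsKG.
have nz : (#|G : K|%:R : F) != 0.
  have p_pr := pcharf_prime pcharF.
  rewrite -(dvdn_pcharf pcharF) -card_quotient ?normal_norm //.
  by rewrite -p'natE.
exists (#|G : K|%:R^-1)%:M; first by move=> x _; rewrite scalar_mxC.
rewrite /hom_trace (eq_bigr (fun=> (#|G : K|%:R^-1)%:M)) => [|C CK].
  by rewrite sumr_const -scaler_nat scale_scalar_mx mulfV.
have Gx := repr_rcosets_mem sKG CK.
by rewrite /conj_hom scalar_mxC -mulmxA -repr_mxM ?groupV // mulVg repr_mx1 mulmx1.
Qed.

(** As the index is prime, [D K] is either [K] or [G]; each case has its own lemma above. *)
Lemma hull_bound_prime_index G K :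
  K <| G -> prime #|G : K| -> hull_bound K -> hull_bound G.
Proof.
move=> nsKG pr_i bK D d rS sDG irrS prS.
have [sKG nKG] := andP nsKG.
have defDK : (D <*> K)%G :=: (D * K)%g by rewrite /= norm_joinEl // (subset_trans
  sDG).
have sDKG : (D <*> K)%G \subset G by rewrite join_subG sDG.
have := Lagrange_index sDKG (joing_subr D K) => ind.
have /(primeP pr_i).2/orP[] : (#|(D <*> K)%G : K| %| #|G :
  K|)%N by rewrite -ind dvdn_mull.
  rewrite indexg_eq1 => sDK.
  apply: (ess_bound_sub_normal (D' := D) nsKG bK sDG) => //.
  by apply: subset_trans sDK; apply: joing_subl.
move=> /eqP i1; apply: (ess_bound_normal_cover nsKG bK sDG) => //.
apply/eqP; rewrite -defDK eqEsubset sDKG -indexg_eq1.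
by rewrite -(eqn_pmul2r (indexg_gt0 (D <*> K)%G K)) ind i1 mul1n eqxx.
Qed.

Lemma hull_bound_pquotient (p : nat) G K :
  K <| G -> p.-group (G / K)%g -> hull_bound K -> hull_bound G.
Proof.
have [m] := ubnP #|G : K|; elim: m G => // m IH G ltm nsKG pGK bK.
have [sKG nKG] := andP nsKG.
have [trivGK | ntGK] := eqVneq (G / K)%g 1%g.
  have -> // : G = K.
  by apply/val_inj/eqP; rewrite eqEsubset sKG andbT -quotient_sub1 // trivGK.
have [p_pr _ _] := pgroup_pdiv pGK ntGK.
have [E | [M maxM _]] := maximal_exists (sub1G (G / K)%G).
  by rewrite -E eqxx in ntGK.
have nsM := p_maximal_normal pGK maxM; have iM := p_maximal_index pGK maxM.
pose H := (coset K @*^-1 M)%G.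
have sMG := normal_sub nsM.
have nsHG : H <| G.
  by rewrite -(quotientGK nsKG) cosetpre_normal.
have sHG := normal_sub nsHG.
have sKH : K \subset H by rewrite -{1}(ker_coset K) ker_sub_pre.
have nsKH : K <| H := normalS sKH sHG nsKG.
have defM : (H / K)%g = M by rewrite /= cosetpreK.
have iH : #|G : H| = p.
  by rewrite -iM -index_cosetpre quotientGK.
apply: (hull_bound_prime_index nsHG); first by rewrite iH.
apply: IH => //; last by rewrite defM (pgroupS sMG).
have := Lagrange_index sHG sKH; rewrite iH => defi.
have := indexg_gt0 H K; have := prime_gt1 p_pr; nia.
Qed.

Lemma hull_bound_p_solvable p G :
  p \in [pchar F] -> p_solvable p G -> hull_bound G.
Proof.
move=> pcharF [s]; elim/last_ind: s G => [|s H IH] G.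
  by move=> _ <-; apply: hull_bound1.
rewrite rcons_path last_rcons => /andP[ser /andP[nsK pK]] <-.
have bK := IH _ ser erefl.
case/orP: pK => pK; first exact: hull_bound_pquotient pK bK.
exact: hull_bound_p'quotient pcharF nsK pK bK.
Qed.

End HullBound.

(** * The regular module *)

Section RegularModule.

Variables (F : fieldType) (gT : finGroupType) (G : {group gT}).
Local Notation aG := (regular_repr F G).
Local Notation R_G := (group_ring F G).

Lemma gring_op_hom m n (r1 : mx_representation F G m) (r2 : mx_representation F G n)
    f A :
  mxhom G r1 r2 f -> (A \in R_G)%MS -> gring_op r1 A *m f = f *m gring_op r2 A.
Proof.
move=> homf /envelop_mxP[a ->]; rewrite !linear_sum mulmx_suml.
apply: eq_bigr => x Gx; rewrite !linearZ /= -?scalemxAl -?scalemxAr.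
by rewrite !gring_opG // homf.
Qed.

Lemma relproj_gring_op (D : {group gT}) n (rG : mx_representation F G n) X :
    D \subset G -> (X \in R_G)%MS ->
    (forall x, x \in D -> aG x *m X = X *m aG x) ->
    gring_op rG (rel_trace D X) = 1%:M ->
  relproj G D rG.
Proof.
move=> sDG RX cX tr1; exists (gring_op rG X).
  move=> x Dx; have Gx := subsetP sDG x Dx.
  by rewrite -(gring_opG rG Gx) -!gring_opM ?envelop_mx_id // cX.
rewrite -[RHS]tr1 /hom_trace /rel_trace linear_sum; apply: eq_bigr => C CD.
have Gx := repr_rcosets_mem sDG CD.
by rewrite /= !gring_opM ?envelop_mx_id // !gring_opG ?groupV.
Qed.

(* The coefficient of g in h(v) is the coefficient of 1 in h(v g^-1).          *)
Lemma regular_hom_eq0 d (rG : mx_representation F G d) (h : 'M_(d, #|G|)) :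
  mxhom G rG aG h -> col (gring_index G 1) h = 0 -> h = 0.
Proof.
move=> homh h0; apply/matrixP => i j; rewrite [RHS]mxE.
have Gx : enum_val j \in G by apply: enum_valP.
have /matrixP/(_ i (gring_index G 1)) := homh _ (groupVr Gx).
rewrite [X in _ = X]mxE (bigD1 j) //= big1 ?addr0 => [|k kj].
  rewrite !mxE /= mulgV !eqxx mulr1 => <-; rewrite big1 // => k _.
  by have /matrixP/(_ k 0) := h0; rewrite !mxE => ->; rewrite mulr0.
rewrite !mxE /= -(inj_eq enum_val_inj) !gring_indexK ?groupM ?groupV ?enum_valP //.
rewrite eq_sym -eq_mulgV1 (inj_eq enum_val_inj) (negPf kj).
by rewrite mulr0.
Qed.

(** Reading the coefficient of 1 embeds Hom(S, F[G]) in the dual of S. *)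
Lemma regular_hom_card d (rG : mx_representation F G d) k (h : 'I_k -> 'M_(d, #|G|)) :
    (forall j, mxhom G rG aG (h j)) ->
    (forall a : 'I_k -> F, \sum_j a j *: h j = 0 -> forall j, a j = 0) ->
  (k <= d)%N.
Proof.
move=> homh freeh.
pose L := \matrix_(j < k, i < d) h j i (gring_index G 1).
suff /eqP <- : row_free L by apply: rank_leq_col.
rewrite -kermx_eq0; apply/rowV0P => u /sub_kermxP uL0.
apply/rowP => j; rewrite mxE; apply: (freeh (fun j => u 0 j)).
apply: (regular_hom_eq0 (rG := rG)) => [x Gx|].
  rewrite mulmx_sumr mulmx_suml; apply: eq_bigr => i _.
  by rewrite -scalemxAr -scalemxAl homh.
apply/colP => i; rewrite mxE [RHS]mxE summxE.
have /rowP/(_ i) := uL0; rewrite !mxE => uL; rewrite -[RHS]uL.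
by apply: eq_bigr => j' _; rewrite !mxE.
Qed.

(** The isomorphisms from [W i0] onto the [W i] with i in [J], followed by [e], are linearly
    independent maps into F[G] because the [W i] are in direct sum. *)
Lemma regular_isotypic_card n (rM : mx_representation F G n) (e : 'M_(n, #|G|))
    (I : finType) (W : I -> 'M_n) (simW : forall i, mxsimple rM (W i))
    (J : {set I}) i0 :
    mxhom G rM aG e -> row_free e -> mxdirect (\sum_i W i) ->
    (forall i, i \in J -> mx_rsim (submod_repr (mxsimple_module (simW i0)))
                            (submod_repr (mxsimple_module (simW i)))) ->
  (#|J| <= \rank (W i0))%N.
Proof.
move=> home freee /mxdirect_sumsP dxW isoJ.
pose rS := submod_repr (mxsimple_module (simW i0)).
have emb i : exists f : 'M_(\rank (W i0), n), i \in J ->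
    [/\ mxhom G rS rM f, row_free f & (f <= W i)%MS].
  have [Ji | _] := boolP (i \in J); last by exists 0.
  have [f _ freef homf] := isoJ i Ji; exists (f *m val_submod 1%:M) => _; split.
  - by apply: mxhomM homf _; apply: val_submod_hom.
  - by rewrite /row_free mxrankMfree ?val_submod_free.
  - by rewrite -val_submodE val_submodP.
have [f fP] := fin_all_exists emb.
apply: (@regular_hom_card _ rS _ (fun j => f (enum_val j) *m e)) => [j | a].
  by have [homf _ _] := fP _ (enum_valP j); apply: mxhomM homf home.
under eq_bigr do rewrite scalemxAl; rewrite -mulmx_suml -[RHS](mul0mx _ e).
move=> /(row_free_inj freee) sum0 j; apply/eqP/idPn => aj.
have [_ freefj sfj] := fP _ (enum_valP j).
have : (a j *: f (enum_val j) <= (0 : 'M_n))%MS.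
  rewrite -(dxW (enum_val j) isT) sub_capmx scalemx_sub //=.
  move/eqP: sum0; rewrite (bigD1 j) //= addr_eq0 => /eqP ->.
  rewrite eqmx_opp.
  apply: summx_sub => j' nj'; have [_ _ sfj'] := fP _ (enum_valP j').
  rewrite scalemx_sub // (sumsmx_sup (enum_val j')) //=.
  by rewrite (inj_eq enum_val_inj).
rewrite eqmx_scale // submx0 -mxrank_eq0 (eqP freefj) mxrank_eq0.
by have [_ /negP nz _] := simW i0.
Qed.

(** Passes from the algebra [B] to the row space of [e], a submodule of the regular module: A = A e
    puts the coefficient row of A in that space. *)
Lemma ideal_rank_le (B : 'A[F]_#|G|) e :
  (B <= R_G)%MS -> mxring_id B e -> (\rank B <= \rank e)%N.
Proof.
move=> sBR [_ Be _ Br]; rewrite -(mxrankMfree e (gring_free F G)).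
apply: mxrankS; apply/memmx_subP => A BA.
rewrite mem_sub_gring (memmx_subP sBR) // -(Br A BA) gring_row_mul.
by rewrite submxMl.
Qed.

Lemma ideal_id_comm (B : 'A[F]_#|G|) e x :
  mx_ideal R_G B -> mxring_id B e -> x \in G -> aG x *m e = e *m aG x.
Proof.
move=> /andP[lB rB] [_ Be Bl Br] Gx; have Rx := envelop_mx_id aG Gx.
have Bxe := memmx_subP lB _ (mem_mulsmx Rx Be).
have Bex := memmx_subP rB _ (mem_mulsmx Be Rx).
by rewrite -(Bl _ Bxe) mulmxA Br.
Qed.

End RegularModule.

(** * Characteristic polynomials and cyclotomic roots *)

Section CharPoly.

Variable F : fieldType.

(** X - A divides X^k - A^k = X^k - c in matrices over F[X]; take determinants. *)
Lemma char_poly_dvd_exp n (A : 'M[F]_n.+1) k c :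
  A ^+ k = c%:M -> char_poly A %| ('X^k - c%:P) ^+ n.+1.
Proof.
move=> Ak; pose x := 'X%:M : 'M[{poly F}]_n.+1; pose y := map_mx polyC A.
have cxy : GRing.comm x y by rewrite /GRing.comm -!mulmxE scalar_mxC.
have /(congr1 determinant) := GRing.subrXX_comm k cxy.
rewrite -mulmxE det_mulmx => det_eq.
have yk : y ^+ k = c%:P%:M by rewrite -rmorphXn /= Ak map_scalar_mx.
have xk : x ^+ k = 'X^k%:M by rewrite -rmorphXn.
rewrite -(det_scalar n.+1 ('X^k - c%:P)).
by rewrite rmorphB /= -yk -xk det_eq dvdp_mulr.
Qed.

Lemma char_poly_split n (A : 'M[F]_n.+1) k c (s : seq F) :
    A ^+ k = c%:M -> 'X^k - c%:P = \prod_(x <- s) ('X - x%:P) ->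
  exists r : seq F, [/\ {subset r <= s}, char_poly A = \prod_(x <- r) ('X - x%:P)
    & \tr A = \sum_(x <- r) x].
Proof.
move=> Ak defs; have := char_poly_dvd_exp Ak; rewrite defs => dvA.
have [t [ts def_t]] : exists t : seq F, {subset t <= s} /\
    (\prod_(x <- s) ('X - x%:P)) ^+ n.+1 = \prod_(x <- t) ('X - x%:P).
  elim: n.+1 => [|m [t [ts IH]]]; first by exists [::]; rewrite big_nil.
  exists (s ++ t); split; last by rewrite exprS IH big_cat.
  by move=> x; rewrite mem_cat => /orP[//|/ts].
rewrite def_t in dvA; have [m eqA] := dvdp_prod_XsubC dvA.
have defA : char_poly A = \prod_(x <- mask m t) ('X - x%:P).
  apply/eqP; rewrite -eqp_monic ?char_poly_monic //.
  exact: monic_prod_XsubC.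
have sz : size (mask m t) = n.+1.
  by apply/eqP; rewrite -eqSS -(size_char_poly A) defA size_prod_XsubC.
exists (mask m t); split=> //; first by move=> x /mem_mask/ts.
have := coefPn_prod_XsubC (ps := mask m t); rewrite sz -defA => /(_ isT).
by rewrite (char_poly_trace A) // => /oppr_inj.
Qed.

Lemma mxtrace_nilpotent n (A : 'M[F]_n.+1) k : A ^+ k = 0 -> \tr A = 0.
Proof.
move=> Ak; have Ak0 : A ^+ k = 0%:M by rewrite Ak rmorph0.
have [|r [r0 _ ->]] := char_poly_split (s := nseq k 0) Ak0.
  by rewrite big_nseq iter_mulr_1 polyC0 !subr0.
by rewrite big_seq big1 // => x /r0; rewrite mem_nseq => /andP[_ /eqP].
Qed.

End CharPoly.

Lemma Cyclotomic_root (L : fieldType) m (z : L) :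
  m.-primitive_root z -> root (map_poly intr 'Phi_m) z.
Proof.
move=> prim; have m_gt0 := prim_order_gt0 prim.
have dvd0 k : (0 < k)%N -> root (map_poly intr 'Phi_k : {poly L}) z -> z ^+ k = 1.
  move=> k_gt0; rewrite /root => rz; apply/eqP; rewrite -subr_eq0.
  have -> : z ^+ k - 1 = (map_poly intr ('X^k - 1) : {poly L}).[z].
    by rewrite rmorphB /= map_polyXn rmorph1 !hornerE.
  rewrite -(prod_Cyclotomic k_gt0) (big_rem k) /=; last by rewrite divisors_id.
  by rewrite rmorphM hornerM (eqP rz) mul0r.
have : root (map_poly intr ('X^m - 1) : {poly L}) z.
  by rewrite /root rmorphB /= map_polyXn rmorph1 !hornerE prim_expr_order // subrr.
rewrite -(prod_Cyclotomic m_gt0) rmorph_prod /root horner_prod prodf_seq_eq0.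
case/hasP => d; rewrite -dvdn_divisors // => dm /= rd.
have d_gt0 := dvdn_gt0 m_gt0 dm.
have : (m %| d)%N by rewrite (prim_order_dvd prim) dvd0.
by move=> md; have /eqP <- : d == m by rewrite eqn_dvd dm.
Qed.

(** Takes the place of reduction modulo a prime above p: the m-th cyclotomic polynomial is the
    minimal polynomial of [omega], divides [q] over the integers, and vanishes at [z] in any
    characteristic. *)
Lemma primitive_root_transfer (L : fieldType) m (omega : algC) (z : L) (q :
  {poly int}) :
    m.-primitive_root omega -> m.-primitive_root z ->
  root (map_poly intr q) omega -> root (map_poly intr q) z.
Proof.
move=> primw primz rq.
have [f [deff monf] fP] := minCpolyP omega.
have eqf : f = map_poly intr 'Phi_m.
  apply: (map_inj_poly (f := ratr : rat -> algC)) => [||]; [exact: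
    fmorph_inj | exact: rmorph0 |].
  rewrite -deff (minCpoly_cyclotomic primw) -(Cintr_Cyclotomic primw).
  by rewrite -map_poly_comp; apply: eq_map_poly => x /=; rewrite ratr_int.
have : ('Phi_m %| q).
  rewrite -dvdp_rat_int -eqf -fP -map_poly_comp.
  by rewrite (eq_map_poly (g := intr)) // => x /=; rewrite ratr_int.
case/dvdpP_int => r ->; rewrite zprimitive_monic ?Cyclotomic_monic //.
by rewrite rmorphM rootM (Cyclotomic_root primz).
Qed.

(** * Traces determine absolutely irreducible representations *)

Section Traces.

Variables (F : fieldType) (gT : finGroupType) (G : {group gT}).
Local Notation aG := (regular_repr F G).
Local Notation R_G := (group_ring F G).

Lemma abs_irr_gring_op_onto n (rG : mx_representation F G n) (M : 'M_n) :
  mx_absolutely_irreducible rG -> exists2 A, (A \in R_G)%MS & gring_op rG A = M.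
Proof.
case/andP => _ full; have /submxP[b defM] := submx_full (mxvec M) full.
exists (gring_mx aG b); first exact: gring_mxP.
by rewrite gring_op_mx /gring_mx /= -defM mxvecK.
Qed.

Lemma mxtrace_mul_eq0 n (A : 'M[F]_n) : (forall B, \tr (A *m B) = 0) -> A = 0.
Proof.
move=> trA; apply/matrixP => i j; rewrite mxE -(trA (delta_mx j i)).
rewrite /mxtrace (bigD1 i) //= big1 ?addr0 => [|k ki].
  rewrite mxE (bigD1 j) //= big1 => [|k kj]; first by rewrite mxE !eqxx mulr1 addr0.
  by rewrite mxE (negPf kj) mulr0.
by rewrite mxE big1 // => l _; rewrite mxE (negPf ki) andbF mulr0.
Qed.

(** For C in the group ring, tr r2(AC) = tr r1(AC) = 0. As r2(C) runs over all matrices,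
    nondegeneracy of the trace form gives r2(A) = 0. *)
Lemma abs_irr_gring_op_ker n1 n2 (r1 : mx_representation F G n1)
    (r2 : mx_representation F G n2) A :
    mx_absolutely_irreducible r2 -> (forall x, x \in G -> \tr (r1 x) = \tr (r2 x)) ->
  (A \in R_G)%MS -> gring_op r1 A = 0 -> gring_op r2 A = 0.
Proof.
move=> irr2 eqtr RA A0.
have eqtrR C : (C \in R_G)%MS -> \tr (gring_op r1 C) = \tr (gring_op r2 C).
  case/envelop_mxP => a ->; rewrite !linear_sum; apply: eq_bigr => x Gx.
  by rewrite !linearZ /= !gring_opG // eqtr.
apply: mxtrace_mul_eq0 => B.
have [C RC <-] := abs_irr_gring_op_onto B irr2.
rewrite -gring_opM // -eqtrR; last exact: envelop_mxM.
by rewrite gring_opM // A0 mul0mx linear0.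
Qed.

Lemma irr_hom_rsim n1 n2 (r1 : mx_representation F G n1)
    (r2 : mx_representation F G n2) f :
    mx_irreducible r1 -> mx_irreducible r2 -> mxhom G r1 r2 f -> f != 0 ->
  mx_rsim r1 r2.
Proof.
case/mx_irrP => _ irr1 /mx_irrP[_ irr2] homf nzf.
have freef : row_free f.
  rewrite -kermx_eq0; apply: contraNT nzf => nzk.
  have full : row_full (kermx f).
    apply: irr1 nzk; apply/mxmoduleP => x Gx; apply/sub_kermxP.
    by rewrite -mulmxA homf // mulmxA mulmx_ker mul0mx.
  apply/eqP/(row_full_inj full).
  by rewrite mulmx_ker mulmx0.
exists f => //.
have : row_full <<f>>%MS.
  apply: irr2; last by rewrite -mxrank_eq0 genmxE mxrank_eq0.
  rewrite (eqmx_module _ (genmxE _)); apply/mxmoduleP => x Gx.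
  by rewrite -homf // submxMl.
by rewrite /row_full genmxE (eqP freef) => /eqP.
Qed.

(* The two kernels in the group ring agree; transport a matrix unit row e_j    *)
(* to r2 through any preimage b j of the matrix unit E_(0,j).                  *)
Lemma abs_irr_trace_rsim n1 n2 (r1 : mx_representation F G n1)
    (r2 : mx_representation F G n2) :
    mx_absolutely_irreducible r1 -> mx_absolutely_irreducible r2 ->
    (forall x, x \in G -> \tr (r1 x) = \tr (r2 x)) ->
  mx_rsim r1 r2.
Proof.
case: n1 r1 => [|n1] r1 irr1 irr2 eqtr; first by case/andP: irr1.
have unit_row j : exists A, (A \in R_G)%MS /\ gring_op r1 A = delta_mx 0 j.
  by have [A RA defA] := abs_irr_gring_op_onto (delta_mx 0 j) irr1; exists A.
have [b bP] := fin_all_exists unit_row.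
have nz0 : gring_op r2 (b 0) != 0.
  have [Rb defb] := bP 0; apply/eqP => /(abs_irr_gring_op_ker irr1).
  rewrite defb => /(_ (fun x Gx => esym (eqtr x Gx)) Rb)/matrixP/(_ 0 0).
  by rewrite !mxE eqxx => /eqP; rewrite oner_eq0.
have [i nzi] : exists i, row i (gring_op r2 (b 0)) != 0.
  apply/existsP; apply: contraNT nz0 => /existsPn z.
  by apply/eqP/row_matrixP => i; rewrite row0; apply/eqP; move: (z i); rewrite negbK.
pose f := \matrix_j row i (gring_op r2 (b j)).
have irr1' := mx_abs_irrW irr1; have irr2' := mx_abs_irrW irr2.
apply: (irr_hom_rsim (f := f)) => //; last first.
  by apply: contraNneq nzi => f0; rewrite -(rowK (fun j =>
    row i (gring_op r2 (b j)))) -/f f0 row0.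
move=> x Gx; apply/row_matrixP => j; rewrite !row_mul rowK mulmx_sum_row.
under eq_bigr do rewrite rowK -linearZ /= -linearZ /=.
rewrite -row_mul -linear_sum /=; congr (row i _).
have Rx := envelop_mx_id aG Gx; have [Rbj defbj] := bP j.
rewrite -linear_sum /= -(gring_opG r2 Gx) -gring_opM //.
(* Under [r1] both elements become the matrix with row 0 equal to row [j] of [r1 x] and zeros
   elsewhere, so [r2] also kills their difference. *)
apply/eqP; rewrite -subr_eq0 -linearB /=; apply/eqP.
apply: abs_irr_gring_op_ker irr2 eqtr _ _.
  rewrite linearB addmx_sub //; last by rewrite eqmx_opp envelop_mxM.
  by rewrite linear_sum summx_sub // => k _; rewrite linearZ scalemx_sub; case:
    (bP k).
rewrite linearB linear_sum /= gring_opM // defbj gring_opG //.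
apply/eqP; rewrite subr_eq0; apply/eqP.
apply/matrixP => k l; rewrite mxE summxE (bigD1 l) //= big1 ?addr0 => [|m ml].
  rewrite linearZ /= (bP l).2 !mxE eqxx andbT (bigD1 j) //= big1 ?addr0 => [|m mj].
    by rewrite !mxE eqxx andbT mulrC.
  by rewrite !mxE (negPf mj) andbF mul0r.
by rewrite linearZ /= (bP m).2 !mxE [l == m]eq_sym (negPf ml) andbF mulr0.
Qed.

(** In characteristic p the p-part of [x] acts unipotently and commutes with the p'-part, so [rG x]
    differs from the image of the p'-part by a nilpotent matrix. *)
Lemma mxtrace_constt (p : nat) n (rG : mx_representation F G n) x :
  p \in [pchar F] -> x \in G -> \tr (rG x) = \tr (rG x.`_p^').
Proof.
case: n rG => [|n] rG pcharF Gx; first by rewrite [rG x]flatmx0 [rG _]flatmx0.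
have p_pr := pcharf_prime pcharF.
have Gp : x.`_p \in G by apply: groupX.
have Gp' : x.`_p^' \in G by apply: groupX.
pose q := (#[x]`_p)%N; set A := rG x.`_p^'; set B := rG x.`_p.
have cAB : A * B = B * A.
  by rewrite /A /B -!mulmxE -!repr_mxM // -!expgD addnC.
have Bq : B ^+ q = 1.
  rewrite /B -repr_mxX //; have -> : (x.`_p ^+ q)%g = 1%g.
    by apply/eqP; rewrite -order_dvdn order_constt.
  by rewrite repr_mx1.
have defx : rG x = A * B.
  by rewrite -mulmxE -repr_mxM // -{1}(consttC p x) (commuteX2 _ _ (commute_refl x)).
have B1q : (B - 1) ^+ q = 0.
  (* The Frobenius identity is taken in the commutative ring [{poly F}] and evaluated at [B]. *)
  have pq : [pchar {poly F}].-nat q.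
    rewrite (eq_pnat _ (pcharf_eq (_ : p \in _))) ?part_pnat //.
    by rewrite (fmorph_pchar (polyC : {rmorphism F -> {poly F}})).
  have := congr1 (horner_mx B) (exprDn_pchar ('X - 1) 1 pq).
  rewrite subrK expr1n !(rmorphXn, rmorphB, rmorphD, rmorph1) /= horner_mx_X Bq.
  by move/eqP; rewrite -subr_eq subrr eq_sym => /eqP.
rewrite defx -(subrK A (A * B)) linearD /= -{2}[A]mulr1 -mulrBr.
rewrite (mxtrace_nilpotent (k := q)) ?add0r //.
rewrite exprMn_comm ?B1q ?mulr0 //.
by apply: GRing.commrB => //; apply: GRing.commr1.
Qed.
End Traces.

(** * Brauer characters *)

Section BrauerCharacters.

Variables (p : nat) (F L : fieldType) (iota : {rmorphism F -> L}).
Variables (zeta : L) (omega : algC) (gT : finGroupType) (G : {group gT}).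
Local Notation m := (#|G|`_p^')%N.
Hypotheses (zetaP : m.-primitive_root zeta) (omegaP : m.-primitive_root omega).
Local Notation brauer rG := (brauer_char p iota zeta omega rG).

Lemma mxtrace_p'elt n (rG : mx_representation F G n) g :
    g \in G -> p^'.-elt g ->
  iota (\tr (rG g)) =
  \sum_(k < m) (mup (zeta ^+ k) (char_poly (map_mx iota (rG g))))%:R * zeta ^+ k.
Proof.
case: n rG => [|n] rG Gg p'g.
  rewrite [rG g]flatmx0 linear0 rmorph0 big1 // => k _.
  by rewrite /char_poly det_mx00 mupNroot ?mul0r // root1.
have Am : map_mx iota (rG g) ^+ m = 1%:M.
  rewrite -rmorphXn /= -repr_mxX //; have -> : (g ^+ m)%g = 1%g.
    apply/eqP; rewrite -order_dvdn -(part_pnat_id p'g) partn_dvd //.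
    exact: order_dvdG.
  by rewrite repr_mx1 map_scalar_mx rmorph1.
have [|r [rs defr trr]] :=
    char_poly_split (s := [seq zeta ^+ k | k <- index_iota 0 m]) Am.
  by rewrite big_map factor_Xn_sub_1.
rewrite -trace_map_mx trr defr.
under [RHS]eq_bigr do rewrite mu_prod_XsubC.
have sum_root x : x \in r -> x = \sum_(k < m) (x == zeta ^+ k)%:R * zeta ^+ k.
  move=> /rs/mapP[k0]; rewrite mem_index_iota => /= ltk0 ->.
  rewrite (bigD1 (Ordinal ltk0)) //= eqxx mul1r big1 ?addr0 // => k nk.
  rewrite (eq_prim_root_expr zetaP) !modn_small ?ltn_ord //.
  by rewrite -[X in (X == _)]/(val (Ordinal ltk0)) val_eqE eq_sym (negPf nk) mul0r.
rewrite big_seq (eq_bigr _ sum_root) -big_seq exchange_big /=.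
apply: eq_bigr => k _; rewrite -mulr_suml -natr_sum; congr (_%:R * _).
by rewrite -sum1_count [RHS]big_mkcond /=; apply: eq_bigr => x _; case: eqP.
Qed.

Lemma brauer_char_mxtrace n1 n2 (r1 : mx_representation F G n1)
    (r2 : mx_representation F G n2) x :
  p \in [pchar F] -> brauer r1 = brauer r2 -> x \in G -> \tr (r1 x) = \tr (r2 x).
Proof.
move=> pcharF eqb Gx; rewrite !(mxtrace_constt _ pcharF Gx).
have Gg : x.`_p^' \in G by apply: groupX.
have p'g : p^'.-elt x.`_p^' by apply: p_elt_constt.
move: (x.`_p^') Gg p'g => g Gg p'g {x Gx}.
apply: (fmorph_inj iota); rewrite !mxtrace_p'elt //.
pose mu n (r : mx_representation F G n) (k : nat) :=
  mup (zeta ^+ k) (char_poly (map_mx iota (r g))).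
(* At [omega] this is the difference of the Brauer characters at [g], at [zeta] that of the
   traces. *)
pose q : {poly int} := \sum_(k < m) ((mu _ r1 k)%:Z - (mu _ r2 k)%:Z) *: 'X^k.
have horner_q (R : comNzRingType) (z : R) : (map_poly intr q).[z] =
    \sum_(k < m) (mu _ r1 k)%:R * z ^+ k - \sum_(k < m) (mu _ r2 k)%:R * z ^+ k.
  rewrite rmorph_sum horner_sum -sumrB; apply: eq_bigr => k _.
  rewrite /= map_polyZ /= map_polyXn hornerZ hornerXn rmorphB /= mulrBl.
  by rewrite -!pmulrn.
have : root (map_poly intr q) zeta.
  apply: (primitive_root_transfer omegaP zetaP).
  rewrite /root horner_q subr_eq0; apply/eqP.
  by move/ffunP/(_ g): eqb; rewrite !ffunE Gg p'g.
by rewrite /root horner_q subr_eq0 => /eqP.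
Qed.

Lemma brauer_char_rsim n1 n2 (r1 : mx_representation F G n1)
    (r2 : mx_representation F G n2) :
    p \in [pchar F] -> group_splitting_field F G ->
    mx_irreducible r1 -> mx_irreducible r2 -> brauer r1 = brauer r2 ->
  mx_rsim r1 r2.
Proof.
move=> pcharF splitG irr1 irr2 eqb.
apply: abs_irr_trace_rsim => [||x Gx]; [exact: splitG | exact: splitG |].
exact: brauer_char_mxtrace.
Qed.

Lemma brauer_char1 n (rG : mx_representation F G n) : brauer rG 1%g = n%:R.
Proof.
rewrite ffunE group1 p_elt1 /= repr_mx1 map_scalar_mx rmorph1.
have -> : char_poly (1%:M : 'M[L]_n) = ('X - 1%:P) ^+ n.
  by rewrite -det_scalar /char_poly /char_poly_mx map_scalar_mx -rmorphB.
have m_gt0 := prim_order_gt0 zetaP.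
rewrite (bigD1 (Ordinal m_gt0)) //= mup_XsubCX expr0 eqxx mulr1 big1 ?addr0 //.
move=> k nk; rewrite mup_XsubCX eq_sym -(prim_order_dvd zetaP).
case: ifP => [/dvdn_leq|]; last by rewrite mul0r.
move=> le; have [k0|k_gt0] := posnP k; first by case/eqP: nk; apply: val_inj.
by have := le k_gt0; rewrite leqNgt ltn_ord.
Qed.

End BrauerCharacters.

Theorem corollary6p3 (p : nat) (F : fieldType) (pcharF : p \in [pchar F])
  (gT : finGroupType) (G N : {group gT}) (nNG : N <| G)
  (splitG : group_splitting_field F G) (splitN : group_splitting_field F N)
  (* the choices entering the definition of Brauer characters *)
  (L : fieldType) (iota : {rmorphism F -> L}) (zeta : L) (omega : algC)
  (zetaP : (#|G|`_p^').-primitive_root zeta)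
  (omegaP : (#|G|`_p^').-primitive_root omega)
  (b : 'A[F]_#|N|) (B : 'A[F]_#|G|)
  (blockb : is_block b) (blockB : is_block B)
  (covBb : block_covers (normal_sub nNG) B b)
  (D : {group gT}) (defD : is_defect_group B D)
  (* phi_0, ..., phi_(l-1) enumerate without repetition the irreducible
     Brauer characters in B, so l = l(B) *)
  (l : nat) (phi : 'I_l -> {ffun gT -> algC}) (inj_phi : injective phi)
  (phiP : forall chi : {ffun gT -> algC},
     irr_brauer_in p iota zeta omega B chi <-> exists i, chi = phi i)
  (sDN : D \subset N) (psolN : p_solvable p N) :
  (\rank B)%:R / #|D|%:R <= \sum_(i < l) phi i 1%g ^+ 2.
Proof.
have [sDG [X [RX cX idX]] _] := defD.
have [idealB _ [C [_ /andP[sBCR _] _]] _] := blockB.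
have sBR : (B <= group_ring F G)%MS := submx_trans (addsmxSl _ _) sBCR.
have bN := hull_bound_p_solvable pcharF psolN.
set e := rel_trace D X in idX; have [_ Be Bl Br] := idX.
have Re : (e \in group_ring F G)%MS := memmx_subP sBR _ Be.
have modE : mxmodule (regular_repr F G) e.
  by apply/mxmoduleP => x Gx; rewrite -(ideal_id_comm idealB idX Gx) submxMl.
pose rB := submod_repr modE.
have freej : row_free (@val_submod F _ e _ 1%:M) by apply: val_submod_free.
(* Simple submodules of [rB] lie in the row space of the idempotent [e], on which [e] acts as the
   identity. *)
have op1 T (simT : mxsimple rB T) :
    gring_op (submod_repr (mxsimple_module simT)) e = 1%:M.
  pose j := val_submod (1%:M : 'M_(\rank T)) *m @val_submod F _ e _ 1%:M.
  have freejT : row_free j by rewrite /row_free mxrankMfree // val_submod1.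
  have homj : mxhom G (submod_repr (mxsimple_module simT)) (regular_repr F G) j.
    apply: mxhomM (val_submod_hom _) (val_submod_hom _).
  apply: (row_free_inj freejT); rewrite (gring_op_hom homj Re) mul1mx.
  rewrite gring_op_id //.
  have /submxP[w ->] : (j <= e)%MS by rewrite mulmx_sub // val_submod1.
  by rewrite -mulmxA Bl.
have prD T (simT : mxsimple rB T) : relproj G D (submod_repr (mxsimple_module simT)).
  by apply: relproj_gring_op sDG RX cX _; apply: op1.
have irrT T (simT : mxsimple rB T) : mx_irreducible (submod_repr (mxsimple_module
  simT)).
  by apply/submod_mx_irr.
pose br T (simT : mxsimple rB T) :=
  brauer_char p iota zeta omega (submod_repr (mxsimple_module simT)).
have brP T (simT : mxsimple rB T) : exists k, br T simT = phi k.
  apply/phiP; exists (\rank T), (submod_repr (mxsimple_module simT)); split=> //.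
  by exists e; rewrite ?op1.
have phi1_nat k : exists n : nat, phi k 1%g = n%:R.
  have /phiP[n [rG [_ _ ->]]] : exists i, phi k = phi i by exists k.
  by exists n; apply: brauer_char1.
have [deg degP] := fin_all_exists phi1_nat.
suff le_rank : (\rank B <= #|D| * \sum_k deg k ^ 2)%N.
  rewrite ler_pdivrMr ?ltr0n ?cardG_gt0 // mulrC.
  under eq_bigr do rewrite degP -natrX.
  by rewrite -natr_sum -natrM ler_nat.
apply: leq_trans (ideal_rank_le sBR idX) _.
apply: (@socle_exists F gT G _ rB) => sB.
have [I W /= simW defW dxW] := Socle_semisimple sB.
have [kap kapP] := fin_all_exists (fun i => brP _ (simW i)).
have rankW i : \rank (W i) = deg (kap i).
  by apply/eqP; rewrite -(eqr_nat algC) -degP -kapP /br brauer_char1.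
have le1 : (\rank e <= \sum_i #|D| * \rank (W i))%N.
  apply: (ess_bound_sum (rM := rB) (simW := simW)) => // [i|T simT].
    exact: (ess_bound_sub_normal nNG bN sDG sDN).
  by rewrite defW simple_Socle.
apply: leq_trans le1 _; rewrite -big_distrr leq_mul2l; apply/orP; right => /=.
(* Grouping the socle summands by Brauer character leaves one claim: at most [deg k] of them, each
   of dimension [deg k], have character [phi k]. *)
rewrite (partition_big kap predT) //=; apply: leq_sum => k _.
rewrite (eq_bigr (fun=> deg k)) => [|i /eqP <-]; last exact: rankW.
rewrite sum_nat_const -[X in (_ <= X)%N]mulnn leq_mul2r; apply/orP; right.
have [-> // | /card_gt0P[i0]] := posnP #|[pred i | kap i == k]|.
rewrite inE => /eqP ki0.
have := @regular_isotypic_card F gT G _ rB (val_submod 1%:M) I W simW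
  [set i | kap i == k] i0 (val_submod_hom modE) freej dxW.
rewrite cardsE => card_le; rewrite -ki0 -rankW [in X in (X <= _)%N]ki0.
apply: card_le => i; rewrite inE => /eqP ki.
apply: (brauer_char_rsim zetaP omegaP) => //.
by apply: etrans (kapP i0) _; rewrite ki0 -ki; apply: esym (kapP i).
Qed.
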